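(* Let $A$ be an abelian group (of arbitrary cardinality). Then there exists a solution $(X,\sigma,\tau)$ whose permutation group $\langle \sigma_x\colon x\in X\rangle$ is isomorphic to $A$.
   Context: A solution is a triple $(X,\sigma,\tau)$ with $X$ a set of arbitrary cardinality and $\sigma,\tau\colon X\times X\to X$. Write $\sigma_x=\sigma(x,\cdot)$, $\tau_y=\tau(\cdot,y)$ and $r(x,y)=(\sigma_x(y),\tau_y(x))$. It is required that: (braid relation) $(\mathrm{id}\times r)(r\times \mathrm{id})(\mathrm{id}\times r)=(r\times \mathrm{id})(\mathrm{id}\times r)(r\times \mathrm{id})$ on $X^3$; (non-degenerate) all $\sigma_x$ and $\tau_y$ are bijections of $X$; (involutive) $r^2=\mathrm{id}_{X^2}$. The permutation group of a solution is the subgroup $\langle \sigma_x\colon x\in X\rangle$ of the symmetric group on $X$. *)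

(* Defs.v *)
From HB Require Import structures.
From mathcomp Require Import all_boot ssralg.
From mathcomp Require Import boolp classical_sets.

Set Implicit Arguments.
Unset Strict Implicit.
Unset Printing Implicit Defensive.

Local Open Scope classical_set_scope.
Local Open Scope group_scope.

(* [{perm X}] is only available for finite types. *)
Record sym (X : Type) := Sym {
  sym_fun :> X -> X;
  sym_bij : bijective sym_fun
}.

Section SymGroup.
Variable X : Type.
Implicit Types f g h : sym X.

Lemma sym_eqP f g : f =1 g -> f = g.
Proof.
case: f g => [f fb] [g gb] /= /funext fg; rewrite -{g}fg in gb *.
by congr Sym; exact: Prop_irrelevance.
Qed.

Definition sym_one : sym X := Sym (@Bijective X X id id (fun=> erefl) (fun=> erefl)).

Definition sym_mul f g : sym X :=
  @Sym X (f \o g) (bij_comp (sym_bij f) (sym_bij g)).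

Lemma sym_inv_ex f : exists g : X -> X, cancel f g /\ cancel g f.
Proof. by have [g fK gK] := sym_bij f; exists g. Qed.

Definition sym_inv_fun f : X -> X := projT1 (cid (sym_inv_ex f)).

Lemma sym_funK f : cancel f (sym_inv_fun f).
Proof. by rewrite /sym_inv_fun; case: cid => g []. Qed.

Lemma sym_invK f : cancel (sym_inv_fun f) f.
Proof. by rewrite /sym_inv_fun; case: cid => g []. Qed.

Definition sym_inv f : sym X := Sym (Bijective (@sym_invK f) (@sym_funK f)).

HB.instance Definition _ := gen_eqMixin (sym X).
HB.instance Definition _ := gen_choiceMixin (sym X).

Lemma sym_mulA : associative sym_mul.
Proof. by move=> f g h; exact: sym_eqP. Qed.

Lemma sym_mul1 : left_id sym_one sym_mul.
Proof. by move=> f; exact: sym_eqP. Qed.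

Lemma sym_mulr1 : right_id sym_one sym_mul.
Proof. by move=> f; exact: sym_eqP. Qed.

Lemma sym_mulV : left_inverse sym_one sym_inv sym_mul.
Proof. by move=> f; apply: sym_eqP => x; exact: sym_funK. Qed.

Lemma sym_mulrV : right_inverse sym_one sym_inv sym_mul.
Proof. by move=> f; apply: sym_eqP => x; exact: sym_invK. Qed.

HB.instance Definition _ := isGroup.Build (sym X)
  sym_mulA sym_mul1 sym_mulr1 sym_mulV sym_mulrV.

End SymGroup.

Section GeneratedGroup.
Variables (G : groupType) (B : set G).

Definition generated : set G :=
  smallest [set H : set G | group_closed (mem H)] B.

Lemma generated_group_closed : group_closed (mem generated).
Proof.
split; first by rewrite inE => H [[H1 _] _]; rewrite inE in H1.
move=> x y; rewrite !inE => gx gy H HB; have [[_ Hdiv] _] := HB.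
by have := Hdiv x y; rewrite !inE; apply; [exact: gx|exact: gy].
Qed.

Definition generated_group := {x : G | x \in generated}.

HB.instance Definition _ := SubChoice.on generated_group.
HB.instance Definition _ :=
  SubChoice_isSubGroup.Build G (mem generated) generated_group
    generated_group_closed.

End GeneratedGroup.

Section Braiding.
Variables (X : Type) (r : X * X -> X * X).

Definition r_id (p : X * X * X) : X * X * X := (r p.1, p.2).

Definition id_r (p : X * X * X) : X * X * X :=
  let q := r (p.1.2, p.2) in (p.1.1, q.1, q.2).

Definition braid_relation := id_r \o r_id \o id_r =1 r_id \o id_r \o r_id.

End Braiding.

(* Curried: [sigma x y] is sigma_x(y), while [tau x y] is tau_y(x). *)
Definition braiding_map (X : Type) (sigma tau : X -> X -> X) (p : X * X) :
  X * X := (sigma p.1 p.2, tau p.1 p.2).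

Record solution := Solution {
  carrier :> Type;
  sigma : carrier -> carrier -> carrier;
  tau : carrier -> carrier -> carrier;
  solution_braid : braid_relation (braiding_map sigma tau);
  sigma_bij : forall x, bijective (sigma x);
  tau_bij : forall y, bijective (tau^~ y);
  solution_involutive : involutive (braiding_map sigma tau)
}.

Definition sigma_perm (S : solution) (x : S) : sym S := Sym (sigma_bij x).

Definition permutation_group (S : solution) : groupType :=
  generated_group (range (@sigma_perm S)).

(* Main.v *)
Require Import Defs.
From mathcomp Require Import all_boot ssralg.
From mathcomp Require Import boolp classical_sets.

Import GRing.Theory.

(** Let [A] act on a set [X] and let [w : X -> A] be constant on orbits. Letting
    [x] act as [w x] defines a solution: since [w] is invariant,
    [sigma_(sigma_x y) = sigma_y], so involutivity forces [tau_y] to be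
    the inverse of [sigma_y], and as [A] is abelian both sides of the braid
    relation move each of the three points by the same element of [A]
    (lemmas [weight_braid] and [weight_involutive]).
    If [w] is moreover surjective, the maps [sigma_x] are exactly the
    permutations given by elements of [A]; these already form a group, so the
    permutation group is the image of [A] in the symmetric group on [X], and it
    is isomorphic to [A] as soon as the action is faithful.

    Two copies of [A] suffice for both requirements: [A] fixes the first copy
    pointwise, so that [w] can be taken there to be the identity, and translates
    the second one, which makes the action faithful; on the second copy, a
    single orbit, [w] is zero. *)

Section WeightedAction.
Variables (A : zmodType) (X : Type) (act : A -> X -> X) (w : X -> A).
Hypothesis act0 : forall x, act 0%R x = x.
Hypothesis actD : forall a b x, act (a + b)%R x = act a (act b x).
Hypothesis w_act : forall a x, w (act a x) = w x.

Lemma act_bij a : bijective (act a).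
Proof. by exists (act (- a)%R) => x; rewrite -actD ?addNr ?addrN act0. Qed.

Definition weight_sigma x y := act (w x) y.
Definition weight_tau x y := act (- w y)%R x.

Lemma weight_braid : braid_relation (braiding_map weight_sigma weight_tau).
Proof.
move=> [[x y] z].
rewrite /r_id /id_r /braiding_map /weight_sigma /weight_tau /= !w_act.
by rewrite -!actD [(w x + w y)%R]addrC [(- w z + _)%R]addrC [(- w z - _)%R]addrC.
Qed.

Lemma weight_involutive : involutive (braiding_map weight_sigma weight_tau).
Proof.
move=> [x y]; rewrite /braiding_map /weight_sigma /weight_tau /= !w_act.
by rewrite -!actD addrN addNr !act0.
Qed.

Definition weight_solution : solution :=
  @Solution X weight_sigma weight_tau weight_braid
    (fun x => act_bij (w x)) (fun y => act_bij (- w y)%R) weight_involutive.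

Definition act_perm a : sym X := Sym (act_bij a).

Lemma act_permD a b : act_perm (a + b)%R = (act_perm a * act_perm b)%g.
Proof. by apply: sym_eqP => x; exact: actD. Qed.

Lemma act_perm0 : act_perm 0%R = 1%g.
Proof. by apply: sym_eqP => x; exact: act0. Qed.

Lemma act_permN a : act_perm (- a)%R = (act_perm a)^-1%g.
Proof. by apply/eqP; rewrite -mulg_eq1 -act_permD addNr act_perm0. Qed.

Lemma range_act_perm_group_closed : group_closed (mem (range act_perm)).
Proof.
split; first by rewrite inE; exists 0%R => //; exact: act_perm0.
move=> _ _ /set_mem [a _ <-] /set_mem [b _ <-].
by rewrite inE; exists (a - b)%R; rewrite // act_permD act_permN.
Qed.

Hypothesis w_surj : forall a, exists x, w x = a.

Lemma generated_sigma_permE :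
  generated (range (@sigma_perm weight_solution)) = range act_perm.
Proof.
have -> : range (@sigma_perm weight_solution) = range act_perm.
  apply/seteqP; split=> [_ [x _ <-]|_ [a _ <-]]; first by exists (w x).
  by have [x <-] := w_surj a; exists x.
rewrite /generated smallest_id //.
exact: range_act_perm_group_closed.
Qed.

Lemma act_perm_generated a :
  act_perm a \in generated (range (@sigma_perm weight_solution)).
Proof. by rewrite generated_sigma_permE inE; exists a. Qed.

Definition act_embedding a : permutation_group weight_solution :=
  exist _ (act_perm a) (act_perm_generated a).

Lemma act_embeddingD :
  {morph act_embedding : a b / (a + b)%R >-> (a * b)%g}.
Proof. by move=> a b; apply: val_inj; rewrite /= act_permD. Qed.

(** A point [x0] with trivial stabilizer is enough for faithfulness, and the
    inverse isomorphism then reads off where a permutation sends [x0]. *)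
Lemma act_embedding_bij (x0 : X) (g : X -> A) :
  (forall a, g (act a x0) = a) -> bijective act_embedding.
Proof.
move=> actK.
have gK a : g (val (act_embedding a) x0) = a by exact: actK.
exists (fun p : permutation_group weight_solution =>
          g ((val p : sym X) x0)) => //.
move=> [p gp]; apply: val_inj => /=.
move: gp; rewrite generated_sigma_permE => /set_mem [a _ <-].
by rewrite /= actK.
Qed.

End WeightedAction.

Theorem theorem7p11 (A : zmodType) :
  exists (S : solution) (f : A -> permutation_group S),
    bijective f /\ {morph f : a b / (a + b)%R >-> (a * b)%g}.
Proof.
pose act (a : A) (x : A + A) := if x is inr b then inr (a + b)%R else x.
pose w (x : A + A) : A := if x is inl a then a else 0%R.
have act0 x : act 0%R x = x by case: x => //= b; rewrite add0r.
have actD a b x : act (a + b)%R x = act a (act b x).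
  by case: x => //= c; rewrite addrA.
have w_act a x : w (act a x) = w x by case: x.
have w_surj a : exists x, w x = a by exists (inl a).
exists (weight_solution _ _ _ _ act0 actD w_act).
exists (act_embedding _ _ _ _ act0 actD w_act w_surj).
split; last exact: act_embeddingD.
apply: (@act_embedding_bij _ _ _ _ _ _ _ _ (inr 0%R)
          (fun x => if x is inr b then b else 0%R)) => a /=.
exact: addr0.
Qed.
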